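(* Let $X\subset \mathbb{P}^N$ be a Segre variety with $\dim X>0$. For every $q\in \mathbb{P}^N$ we have $\mathcal{S}(X,q,r_X(q)+1)\neq\emptyset$; that is, there is a set $S\subset X$ with $\#S=r_X(q)+1$ which irredundantly spans $q$.
   Context: Everything is over an algebraically closed field $\mathbb{K}$. A multiprojective space is a product $\mathbb{P}^{n_1}\times\cdots\times\mathbb{P}^{n_k}$ with $k\ge 1$ and $n_i>0$ for all $i$. Its Segre embedding is $\nu:\mathbb{P}^{n_1}\times\cdots\times\mathbb{P}^{n_k}\to\mathbb{P}^N$, $N=(n_1+1)\cdots(n_k+1)-1$, $([v_1],\dots,[v_k])\mapsto[v_1\otimes\cdots\otimes v_k]$. A Segre variety $X\subset\mathbb{P}^N$ is the image of such an embedding, so $X$ spans $\mathbb{P}^N$. The case $k=1$, where $X=\mathbb{P}^N$, is allowed. $\langle\ \rangle$ denotes linear span in projective space. A finite set $A\subset\mathbb{P}^N$ irredundantly spans $q\in\mathbb{P}^N$ if $q\in\langle A\rangle$ and $q\notin\langle A'\rangle$ for every proper subset $A'\subsetneq A$. The $X$-rank $r_X(q)$ of $q\in\mathbb{P}^N$ is the minimal cardinality of a finite set $A\subset X$ with $q\in\langle A\rangle$. For a positive integer $t$, $\mathcal{S}(X,q,t)$ is the set of all $A\subset X$ such that $\#A=t$ and $A$ irredundantly spans $q$. *)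

(* Defs.v *)
From HB Require Import structures.
From mathcomp Require Import all_boot all_order all_algebra.
From mathcomp Require Import finmap.
From mathcomp Require Import boolp classical_sets.

Set Implicit Arguments.
Unset Strict Implicit.
Unset Printing Implicit Defensive.

Import GRing.Theory.

Local Open Scope ring_scope.
Local Open Scope classical_set_scope.

Section ProjectiveSpace.
Variables (K : fieldType) (V : vectType K).

(* P(V): the points are the lines through the origin of V. *)
Record pspace := PPoint { pline :> {vspace V}; _ : \dim pline == 1%N }.

HB.instance Definition _ := [isSub for pline].
HB.instance Definition _ := [Choice of pspace by <:].

Lemma dim_pline (p : pspace) : \dim (pline p) = 1%N.
Proof. by case: p => U /= /eqP. Qed.

Lemma dim_vline_neq0 (v : V) : v != 0 -> \dim <[v]> == 1%N.
Proof. by move=> v0; rewrite dim_vline v0. Qed.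

(* The point [v] of P(V). *)
Definition ppoint (v : V) (v0 : v != 0) : pspace := PPoint (dim_vline_neq0 v0).

Definition prepr (p : pspace) : V := vpick (pline p).

Lemma prepr_neq0 p : prepr p != 0.
Proof. by rewrite vpick0 -dimv_eq0 dim_pline. Qed.

Lemma ppoint_eq v (v0 : v != 0) (p : pspace) : v \in pline p -> ppoint v0 = p.
Proof.
move=> vp; apply/val_inj/eqP; rewrite eqEdim /= -memvE vp /=.
by rewrite dim_pline dim_vline v0.
Qed.

Lemma preprK p : ppoint (prepr_neq0 p) = p.
Proof. by apply: ppoint_eq; apply: memv_pick. Qed.

Definition pspan (A : {fset pspace}) : set pspace :=
  [set q | (pline q <= \sum_(p <- A) pline p)%VS].

Definition irr_spans (A : {fset pspace}) (q : pspace) : Prop :=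
  pspan A q /\
  (forall A' : {fset pspace}, (A' `<` A)%fset -> ~ pspan A' q).

Definition spanned_by (X : set pspace) (q : pspace) : set nat :=
  [set r | exists A : {fset pspace},
     [/\ [set` A] `<=` X, #|` A| = r & pspan A q]].

(* The minimum of [spanned_by X q]; the default value 0 is returned only if q
   is not in the span of X, which does not occur for Segre varieties, see
   [xrank_segreP] below. *)
Definition xrank (X : set pspace) (q : pspace) : nat :=
  xget 0%N [set r | spanned_by X q r /\
                    forall s, spanned_by X q s -> (r <= s)%N].

Definition irr_sets (X : set pspace) (q : pspace) (t : nat) :
    set {fset pspace} :=
  [set A | [/\ [set` A] `<=` X, #|` A| = t & irr_spans A q]].

Lemma xrankP (X : set pspace) (q : pspace) : spanned_by X q !=set0 ->
  spanned_by X q (xrank X q) /\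
  (forall s, spanned_by X q s -> (xrank X q <= s)%N).
Proof.
move=> [s hs]; rewrite /xrank.
set P := [set r | _].
suff [r Pr] : exists r, P r by case: xgetP => [r' _ //|/(_ r)].
have ex : exists n, `[< spanned_by X q n >] by exists s; apply/asboolP.
case: (ex_minnP ex) => r /asboolP hr rmin.
by exists r; split=> // t ht; apply/rmin/asboolP.
Qed.

End ProjectiveSpace.

Arguments ppoint {K V v} v0.

Section Segre.
Variables (K : fieldType) (k : nat) (n : 'I_k -> nat).

Definition multi_index := {dffun forall i : 'I_k, 'I_(n i).+1}.

(* K^(n_1 + 1) (x) ... (x) K^(n_k + 1), in coordinates with respect to the
   tensor products of the standard basis vectors. Its dimension is
   (n_1 + 1) ... (n_k + 1), so that [pspace tensor] is P^N. *)
Definition tensor : vectType K := {ffun multi_index -> K^o}.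

Lemma dim_tensor : \dim {: tensor} = (\prod_(i < k) (n i).+1)%N.
Proof.
rewrite dimvf /tensor /= /dim /= muln1 card_dep_ffun foldrE big_map enumT.
by apply: eq_bigr => i _; rewrite card_ord.
Qed.

Definition multiproj := forall i : 'I_k, pspace 'rV[K]_(n i).+1.

(* v_1 (x) ... (x) v_k *)
Definition pure_tensor (v : forall i : 'I_k, 'rV[K]_(n i).+1) : tensor :=
  [ffun j : multi_index => \prod_(i < k) v i ord0 (j i)].

Lemma pure_tensor_neq0 (v : forall i : 'I_k, 'rV[K]_(n i).+1) :
  (forall i, v i != 0) -> pure_tensor v != 0.
Proof.
move=> v0.
have ex i : exists j, v i ord0 j != 0.
  by have /rV0Pn := v0 i.
pose j : multi_index := [ffun i => xchoose (ex i)].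
apply/eqP => /ffunP /(_ j) /eqP; apply/negP; rewrite !ffunE.
apply/prodf_neq0 => i _; rewrite ffunE; exact: xchooseP (ex i).
Qed.

(* ([v_1], ..., [v_k]) |-> [v_1 (x) ... (x) v_k], defined through arbitrary
   representatives; [segreE] says that their choice is immaterial. *)
Definition segre (x : multiproj) : pspace tensor :=
  ppoint (pure_tensor_neq0 (fun i => prepr_neq0 (x i))).

Lemma segreE (v : forall i : 'I_k, 'rV[K]_(n i).+1) (v0 : forall i, v i != 0) :
  segre (fun i => ppoint (v0 i)) = ppoint (pure_tensor_neq0 v0).
Proof.
apply: ppoint_eq => /=.
pose w i := prepr (ppoint (v0 i)).
have ex i : exists c, w i == c *: v i.
  have : w i \in <[v i]>%VS by apply: (memv_pick (pline (ppoint (v0 i)))).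
  by move=> /vlineP[c ->]; exists c.
apply/vlineP; exists (\prod_(i < k) xchoose (ex i)).
apply/ffunP => j; rewrite !ffunE /GRing.scale /= -big_split /=.
apply: eq_bigr => i _; have /eqP := xchooseP (ex i).
by rewrite /w => {1}->; rewrite mxE.
Qed.

Definition segre_variety : set (pspace tensor) := range segre.

Lemma segre_spans (q : pspace tensor) : spanned_by segre_variety q !=set0.
Proof.
pose e (j : multi_index) i : 'rV[K]_(n i).+1 := delta_mx ord0 (j i).
have e0 j i : e j i != 0.
  by apply/eqP => /rowP /(_ (j i)) /eqP; rewrite !mxE !eqxx oner_eq0.
pose f j := ppoint (pure_tensor_neq0 (e0 j)).
pose A : {fset pspace tensor} := [fset f j | j in multi_index]%fset.
exists #|` A|, A; split=> //.
  move=> p /= /imfsetP[j _ ->]; exists (fun i => ppoint (e0 j i)) => //.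
  exact: segreE.
apply/subvP => t _.
have -> : t = \sum_j t j *: pure_tensor (e j).
  apply/ffunP => j; rewrite sum_ffunE (bigD1 j) //= big1 ?addr0.
    rewrite !ffunE big1; first by rewrite /GRing.scale /= mulr1.
    by move=> i _; rewrite mxE !eqxx.
  move=> j' j'j; rewrite !ffunE.
  have [i ij] : exists i, j' i != j i.
    apply/existsP; apply: contraR j'j; rewrite negb_exists => /forallP h.
    apply/eqP/ffunP => i; have := h i; rewrite negbK => /eqP; exact.
  by rewrite (bigD1 i) //= mxE eqxx /= eq_sym (negPf ij) mul0r scaler0.
apply: memv_suml => j _; apply: memvZ.
have fA : f j \in A by apply/imfsetP; exists j.
rewrite (big_fsetD1 (f j)) //=.
by apply: (subvP (addvSl _ _)); apply: memv_line.
Qed.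

Lemma xrank_segreP (q : pspace tensor) :
  spanned_by segre_variety q (xrank segre_variety q) /\
  (forall s, spanned_by segre_variety q s -> (xrank segre_variety q <= s)%N).
Proof. exact: xrankP (segre_spans q). Qed.

End Segre.

Arguments tensor K {k} n.
Arguments segre_variety K {k} n.

(* Main.v *)
Require Import Defs.
From mathcomp Require Import all_boot all_order all_algebra.
From mathcomp Require Import finmap.
From mathcomp Require Import boolp classical_sets.

Set Implicit Arguments.
Unset Strict Implicit.
Unset Printing Implicit Defensive.

Local Open Scope classical_set_scope.

(** Let [A] be a set of [r = r_X(q)] points of [X] spanning [q], let [p] be one of
    them, [B = A \ p], and let [L] be a line contained in [X] and passing through
    [p]. Then [L] does not meet [<B>]: otherwise, writing [q = a + b] with [a] over
    [p], [b] in the span of [B], and taking [w <> 0] over a common point of [L] and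
    [<B>], a suitable scalar [t] makes [b - t w] lie in the span of [B] minus a
    point, and [q = (a + t w) + (b - t w)] has rank less than [r]. Hence, if
    [a = u + v] with [u] and [v] over two other points of [L], replacing [p] by
    [[u]] and [[v]] turns [A] into a set of [r + 1] points irredundantly spanning
    [q]. Every point of a Segre variety lies on a line of the variety: move one of
    the factors along a line. *)

Import GRing.Theory.
Local Open Scope ring_scope.

Lemma fsetD1C (T : choiceType) (A : {fset T}) (x y : T) :
  (A `\ x `\ y = A `\ y `\ x)%fset.
Proof. by rewrite !fsetDDl fsetUC. Qed.

Section Hull.
Context {K : fieldType} {V : vectType K}.
Implicit Types (p q x : pspace V) (A B : {fset pspace V}).

Definition hull A : {vspace V} := (\sum_(p <- A) pline p)%VS.

Lemma pline_hull p A : p \in A -> (pline p <= hull A)%VS.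
Proof. by move=> pA; rewrite /hull (big_fsetD1 p) //= addvSl. Qed.

Lemma hull_subv A (W : {vspace V}) :
  (forall p, p \in A -> (pline p <= W)%VS) -> (hull A <= W)%VS.
Proof.
move=> AW; rewrite /hull big_seq; elim/big_ind: _ => //; first exact: sub0v.
by move=> U1 U2 U1W U2W; rewrite subv_add U1W.
Qed.

Lemma hullS A B : (A `<=` B)%fset -> (hull A <= hull B)%VS.
Proof. by move=> /fsubsetP AB; apply: hull_subv => p /AB /pline_hull. Qed.

Lemma hullU1 p A : hull (p |` A)%fset = (pline p + hull A)%VS.
Proof.
apply/eqP; rewrite eqEsubv; apply/andP; split.
  apply: hull_subv => x; rewrite in_fset1U => /orP[/eqP->|xA].
    exact: addvSl.
  by apply: (subv_trans (pline_hull xA)); apply: addvSr.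
by rewrite subv_add hullS ?fsubsetU1 // pline_hull ?fset1U1.
Qed.

Lemma hullD1 p A : p \in A -> hull A = (pline p + hull (A `\ p)%fset)%VS.
Proof. by move=> pA; rewrite -hullU1 fsetD1K. Qed.

Lemma memv_pline p (u v : V) : u \in pline p -> u != 0 -> v \in pline p ->
  exists c, v = c *: u.
Proof.
move=> up u0; rewrite -(ppoint_eq u0 up) => /vlineP[c ->].
by exists c.
Qed.

(** Induction on the size of [A]. Split [w] and [b] along a point [y] of [A]: if [w] has a nonzero
    part over [y], some [t] cancels the part of [b] there; otherwise [w] lies in the hull of [A]
    minus [y]. *)
Lemma hull_exchange A (w b : V) : w \in hull A -> w != 0 -> b \in hull A ->
  exists2 x, x \in A & exists t, b - t *: w \in hull (A `\ x)%fset.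
Proof.
have [m] := ubnP #|` A|; elim: m A w b => // m IH A w b Am wA w0 bA.
have [A0|[y yA]] := fset_0Vmem A.
  by move: wA; rewrite A0 /hull big_seq_fset0 memv0 (negPf w0).
move: wA bA; rewrite (hullD1 yA) => /memv_addP[w1 w1y [w2 w2A ew]].
move=> /memv_addP[b1 b1y [b2 b2A eb]].
have [w10|w10] := eqVneq w1 0; last first.
  have [t b1E] := memv_pline w1y w10 b1y.
  exists y => //; exists t.
  by rewrite eb ew b1E scalerDr opprD addrACA subrr add0r memvB // memvZ.
move: ew; rewrite w10 add0r => ew.
have Ay : (#|` (A `\ y)%fset| < m)%N.
  by move: Am; rewrite (cardfsD1 y) yA.
rewrite -ew in w2A; have [x xA [t tx]] := IH _ w b2 Ay w2A w0 b2A.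
move: xA; rewrite in_fsetD1 => /andP[xy xA].
exists x => //; exists t.
(* As [y] survives the removal of [x], the part [b1] of [b] over [y] can be put back. *)
have yAx : y \in (A `\ x)%fset by rewrite in_fsetD1 eq_sym xy.
rewrite eb -addrA (hullD1 yAx) fsetD1C memv_add //.
Qed.

End Hull.

Section LineThroughPoint.
Context {K : fieldType} {V : vectType K}.
Variables (X : set (pspace V)) (q p : pspace V) (B : {fset pspace V}).
Variable L : {vspace V}.
Hypothesis BX : forall x, x \in B -> X x.
Hypothesis pBq : prepr q \in (pline p + hull B)%VS.
(** Minimality of [r], since [B] has [r - 1] points. *)
Hypothesis card_min : forall s, spanned_by X q s -> (#|` B| < s)%N.
Hypothesis pL : (pline p <= L)%VS.
Hypothesis LX : forall x, (pline x <= L)%VS -> X x.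

Lemma small_notin_hull (C : {fset pspace V}) :
  (forall x, x \in C -> X x) -> (#|` C| <= #|` B|)%N ->
  prepr q \notin hull C.
Proof.
move=> CX Csmall; apply/negP => qC.
suff /card_min : spanned_by X q #|` C| by rewrite ltnNge Csmall.
exists C; split => //.
rewrite /pspan /= -(preprK q) /= -memvE; exact: qC.
Qed.

Lemma small_notin_hullU1 x y : X y -> x \in B ->
  prepr q \notin (pline y + hull (B `\ x)%fset)%VS.
Proof.
move=> Xy xB; rewrite -hullU1; apply: small_notin_hull => [z|].
  by rewrite !in_fsetE => /orP[/eqP->//|/andP[_ /BX]].
(* Only an inequality, as [y] may already lie in [B] minus [x]. *)
rewrite (cardfsD1 x B) xB.
by rewrite cardfsU1 leq_add2r leq_b1.
Qed.

Lemma line_disjoint_hull w : w \in L -> w \in hull B -> w = 0.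
Proof.
move=> wL wB; apply/eqP; apply/negP => /negP w0.
have /memv_addP[a ap [b bB eq_q]] := pBq.
have [x xB [t tx]] := hull_exchange wB w0 bB.
have qE : prepr q = (a + t *: w) + (b - t *: w).
  by rewrite addrACA subrr addr0.
have aL : a + t *: w \in L by rewrite memvD ?memvZ // (subvP pL).
(* The zero vector gives no point of [L]; then [p] serves as the extra point. *)
have [u0|u0] := eqVneq (a + t *: w) 0.
  have := small_notin_hullU1 (LX pL) xB.
  by rewrite qE u0 add0r (subvP (addvSr _ _)).
have Xu : X (ppoint u0) by apply: LX; rewrite -memvE.
by have := small_notin_hullU1 Xu xB; rewrite qE memv_add ?memv_line.
Qed.

Lemma line_irr_sets : ~~ (L <= pline p)%VS -> irr_sets X q #|` B|.+2 !=set0.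
Proof.
move=> /subvPn[u uL up].
have /memv_addP[a ap [b bB eq_q]] := pBq.
have aL := subvP pL _ ap.
have a0 : a != 0.
  apply/eqP => a0; have := small_notin_hull BX (leqnn _).
  by rewrite eq_q a0 add0r bB.
have a_notin c (v : V) : a = c *: v -> v \in pline p.
  move=> ac; have c0 : c != 0.
    by apply: contraNneq a0 => c0; rewrite ac c0 scale0r.
  by rewrite -(scalerK c0 v) -ac memvZ.
have u0 : u != 0 by apply: contraNneq up => ->; apply: mem0v.
have vp : a - u \notin pline p.
  by apply: contra up => vp; rewrite -(subKr a u) memvB.
have v0 : a - u != 0 by apply: contraNneq vp => ->; apply: mem0v.
have vL : a - u \in L by rewrite memvB.
have LB z : (pline z <= L)%VS -> z \notin B.
  move=> zL; apply/negP => /pline_hull zB; move: (prepr_neq0 z) => /eqP; apply.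
  have zz : prepr z \in pline z := memv_pick _.
  exact: line_disjoint_hull (subvP zL _ zz) (subvP zB _ zz).
have [pu puE] : exists z : pspace V, pline z = <[u]>%VS by exists (ppoint u0).
have [pv pvE] : exists z : pspace V, pline z = <[a - u]>%VS
  by exists (ppoint v0).
have puL : (pline pu <= L)%VS by rewrite puE -memvE.
have pvL : (pline pv <= L)%VS by rewrite pvE -memvE.
(* If [a - u = c *: u], then [a = (c + 1) *: u], which puts [u] over [p]. *)
have puv : pu != pv.
  apply/eqP => /(congr1 (@pline _ _)); rewrite puE pvE => uv.
  have /vlineP[c vc] : a - u \in <[u]>%VS by rewrite uv memv_line.
  case/negP: up; apply: (a_notin (c + 1)).
  by rewrite scalerDl scale1r -vc subrK.
pose S := (pu |` (pv |` B))%fset.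
exists S; split.
- move=> x /=; rewrite /S !in_fset1U => /or3P[/eqP->|/eqP->|/BX//]; exact: LX.
- by rewrite !cardfsU1 in_fset1U negb_or puv !LB.
split.
  rewrite /pspan /= -(preprK q) /= -memvE -/(hull S) !hullU1 eq_q.
  by rewrite puE pvE -{1}(subrKC u a) -addrA !memv_add ?memv_line.
move=> S' /andP[/fsubsetP S'S /fsubsetPn[x xS xS']] S'q.
have qS' : prepr q \in hull S' by apply: (subvP S'q); apply: memv_pick.
have sub T : (forall y, y != x -> y \in S -> y \in T) -> prepr q \in hull T.
  move=> sT; apply: (subvP (hullS _)) qS'; apply/fsubsetP => y yS'.
  by apply: sT (S'S _ yS'); apply: contraNneq xS' => <-.
have one y : y \in L -> prepr q \in (<[y]> + hull B)%VS -> y \in pline p.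
  move=> yL; rewrite eq_q => /memv_addP[z /vlineP[c ->] [b' b'B e]].
  apply: (a_notin c); apply/eqP; rewrite -subr_eq0; apply/eqP.
  apply: line_disjoint_hull; first by rewrite memvB ?memvZ.
  have -> : a - c *: y = b' - b
    by rewrite -[a](addrK b) e addrAC [_ + b']addrC addrK.
  by rewrite memvB.
have [xu|xu] := eqVneq x pu.
  case/negP: vp; apply: one => //; rewrite -pvE -hullU1.
  apply: sub => y; rewrite xu => /eqP yu.
  case/fset1UP=> [/yu[]|/fset1UP[->|]]; [exact: fset1U1|exact: fset1Ur].
have [xv|xv] := eqVneq x pv.
  case/negP: up; apply: one => //; rewrite -puE -hullU1.
  apply: sub => y; rewrite xv => /eqP yv.
  case/fset1UP=> [->|/fset1UP[/yv[]|]]; [exact: fset1U1|exact: fset1Ur].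
have xB : x \in B.
  move: xu xv => /eqP xu /eqP xv.
  by case/fset1UP: xS => [/xu[]|/fset1UP[/xv[]|]].
(* The same comparison, with [y1 + y2] in [L], gives [b = b']. Then [p] and [B] minus [x] span [q]
   with only [r - 1] points. *)
have : prepr q \in (pline pu + (pline pv + hull (B `\ x)%fset))%VS.
  rewrite -!hullU1; apply: sub => y yx.
  by rewrite /S !in_fset1U (in_fsetD1 B) yx.
rewrite eq_q => /memv_addP[y1 y1u [y' /memv_addP[y2 y2v [b' b'B ->]] e]].
have yL : y1 + y2 \in L.
  by rewrite memvD //; [apply: (subvP puL)|apply: (subvP pvL)].
have b'B1 : b' \in hull B by apply: (subvP (hullS _)) b'B; apply: fsubsetDl.
have E : a - (y1 + y2) = b' - b.
  by rewrite -[a](addrK b) e addrA [_ + b']addrC addrAC addrK.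
have /eqP : b' - b = 0.
  by apply: line_disjoint_hull; [rewrite -E|]; apply: memvB.
rewrite subr_eq0 => /eqP bE.
have := small_notin_hullU1 (LX pL) xB.
by rewrite eq_q memv_add // -bE.
Qed.

End LineThroughPoint.

Section SegreLines.
Context {K : fieldType} {k : nat} {n : 'I_k -> nat}.
Implicit Type v : forall i : 'I_k, 'rV[K]_(n i).+1.

(** Each coordinate is a product with exactly one entry from the [i]-th vector. *)
Lemma pure_tensor_linear v i (c d : K) (x y : 'rV[K]_(n i).+1) :
  pure_tensor (dfwith v (c *: x + d *: y)) =
    c *: (pure_tensor (dfwith v x) : tensor K n) +
    d *: pure_tensor (dfwith v y).
Proof.
apply/ffunP => j; rewrite !ffunE /GRing.scale /=.
rewrite !(bigD1 (P := predT) i) //= !dfwith_in !mxE.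
have E (z : 'rV[K]_(n i).+1) : \prod_(l < k | l != i) dfwith v z l ord0 (j l) =
    \prod_(l < k | l != i) v l ord0 (j l).
  by apply: eq_bigr => l il; rewrite dfwith_out 1?eq_sym.
by rewrite !E mulrDl -!mulrA.
Qed.

Lemma segre_variety_line (p : pspace (tensor K n)) i :
  (0 < n i)%N -> segre_variety K n p ->
  exists L : {vspace tensor K n},
    [/\ (pline p <= L)%VS, ~~ (L <= pline p)%VS &
        forall x, (pline x <= L)%VS -> segre_variety K n x].
Proof.
move=> ni_gt0 [m _ <-].
pose v l := prepr (m l); have v0 l : v l != 0 := prepr_neq0 (m l).
have [w _ wv] : exists2 w, w \in fullv & w \notin <[v i]>%VS.
  apply/subvPn; apply/negP => /dimvS.
  by rewrite dim_vline v0 dimvf /dim /= mul1n ltnS leqNgt ni_gt0.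
have upd0 (z : 'rV[K]_(n i).+1) : z != 0 -> forall l, dfwith v z l != 0.
  by move=> z0 l; case: dfwithP.
have updv : dfwith v (v i) = v.
  by apply: functional_extensionality_dep => l; case: dfwithP.
pose t (z : 'rV[K]_(n i).+1) : tensor K n := pure_tensor (dfwith v z).
have tv : t (v i) = pure_tensor v by rewrite /t updv.
exists (<[t (v i)]> + <[t w]>)%VS; split.
- by rewrite /= -tv addvSl.
- rewrite /= -tv; apply/negP => /(subvP)/(_ (t w)).
  rewrite (subvP (addvSr _ _)) ?memv_line // => /(_ isT)/vlineP[c tw].
  (* If [t w = c *: t (v i)], the nonzero vector [w - c *: v i] would give a zero pure tensor. *)
  have z0 : 1 *: w + (- c) *: v i != 0.
    apply: contraNneq wv; rewrite scale1r scaleNr => /eqP.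
    rewrite subr_eq0 => /eqP->.
    by rewrite memvZ ?memv_line.
  have := pure_tensor_neq0 (upd0 _ z0).
  by rewrite pure_tensor_linear -/(t w) tw scale1r scaleNr subrr eqxx.
move=> x xL.
have : prepr x \in (<[t (v i)]> + <[t w]>)%VS.
  by apply: (subvP xL); apply: memv_pick.
move=> /memv_addP[_ /vlineP[c ->] [_ /vlineP[d ->]]].
(* By linearity every vector of [L] is itself a pure tensor [t z]. *)
rewrite -pure_tensor_linear; set z := _ + _ => xz.
have z0 : z != 0.
  apply: contraNneq (prepr_neq0 x) => z0.
  have -> : prepr x = 0 *: t (v i) + 0 *: t w.
    by rewrite xz -pure_tensor_linear !scale0r addr0 z0.
  by rewrite !scale0r addr0.
exists (fun l => ppoint (upd0 z z0 l)) => //.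
rewrite segreE; apply: ppoint_eq; rewrite -xz; exact: memv_pick.
Qed.

End SegreLines.

Theorem theorem1p2 (K : closedFieldType) (k : nat) (n : 'I_k -> nat)
    (k_gt0 : (0 < k)%N) (n_gt0 : forall i : 'I_k, (0 < n i)%N)
    (dim_gt0 : (0 < \sum_(i < k) n i)%N)
    (q : pspace (tensor K n)) :
  irr_sets (segre_variety K n) q (xrank (segre_variety K n) q).+1 !=set0.
Proof.
have [[A [AX Ar Aq]] r_min] := xrank_segreP q.
have [A0|[p pA]] := fset_0Vmem A.
  move: Aq; rewrite A0 /pspan /= big_seq_fset0 subv0 -dimv_eq0.
  by rewrite (dim_pline q).
(* The factor that moves is the first one. *)
have [L [pL Lp LX]] := segre_variety_line (n_gt0 (Ordinal k_gt0)) (AX _ pA).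
rewrite -Ar (cardfsD1 p) pA; apply: (line_irr_sets _ _ _ pL LX Lp).
- by move=> x; rewrite in_fsetD1 => /andP[_ /AX].
- by rewrite -hullD1 //; apply: (subvP Aq); apply: memv_pick.
- by move=> s /r_min; rewrite -Ar (cardfsD1 p) pA.
Qed.
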